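(* There is a family $\mathcal{H}_1$ of $\mathfrak{c}$ many pairwise non-isomorphic Boolean subalgebras of $\wp(\omega)$, each of which is an $\mathbb{F}_{\sigma\delta}$ subset of $2^\omega$, such that each algebra in $\mathcal{H}_1$ has the Nikodym property but not the Grothendieck property.
   Context: $\mathfrak{c}$ denotes the cardinality of the continuum. Subsets of $\omega$ are identified with points of the Cantor space $2^\omega$ via characteristic functions, so families of subsets of $\omega$ (e.g. Boolean subalgebras of $\wp(\omega)$) are subsets of $2^\omega$ and have a Borel class. For a Boolean algebra $\mathcal{A}$, a measure on $\mathcal{A}$ is a finitely additive $\mu\colon\mathcal{A}\to\mathbb{R}$ with finite variation norm $\|\mu\|=\sup\{|\mu(A)|+|\mu(B)|\colon A,B\in\mathcal{A},\ A\wedge B=0\}$; $\mathrm{ba}(\mathcal{A})$ is the Banach space of such measures with this norm. $\mathcal{A}$ has the Nikodym property if every sequence $(\mu_n)$ in $\mathrm{ba}(\mathcal{A})$ with $\lim_n\mu_n(A)=0$ for every $A\in\mathcal{A}$ is norm bounded. $\mathcal{A}$ has the Grothendieck property if every norm bounded sequence $(\mu_n)$ in $\mathrm{ba}(\mathcal{A})$ with $\lim_n\mu_n(A)=0$ for every $A\in\mathcal{A}$ converges to $0$ in the weak topology of the Banach space $\mathrm{ba}(\mathcal{A})$. *)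

(* Defs.v *)
From HB Require Import structures.
From mathcomp Require Import all_boot all_order all_algebra.
From mathcomp Require Import all_classical all_reals all_analysis borel_hierarchy.

Set Implicit Arguments.
Unset Strict Implicit.
Unset Printing Implicit Defensive.

Import Order.TTheory GRing.Theory Num.Theory.
Import numFieldNormedType.Exports.

Local Open Scope classical_set_scope.
Local Open Scope ring_scope.

(* A Boolean algebra is a [ctbDistrLatticeType]. *)

Definition boolalg_isomorphic (d d' : Order.disp_t)
    (A : ctbDistrLatticeType d) (B : ctbDistrLatticeType d') : Prop :=
  exists f : A -> B,
    [/\ bijective f,
        f \bot%O = \bot%O /\ f \top%O = \top%O,
        {morph f : a b / (a `&` b)%O},
        {morph f : a b / (a `|` b)%O} &
        {morph f : a / (~` a)%O}].

Section ba.
Variables (R : realType) (d : Order.disp_t) (A : ctbDistrLatticeType d).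
Implicit Types mu nu : A -> R.

Definition fin_additive mu : Prop :=
  forall a b : A, (a `&` b = \bot)%O -> mu (a `|` b)%O = mu a + mu b.

Definition variations mu : set R :=
  [set r | exists a b : A, (a `&` b = \bot)%O /\ r = `|mu a| + `|mu b|].

Definition variation mu : R := sup (variations mu).

(* The least upper bound of the nonempty set [variations mu] is finite. *)
Definition finite_variation mu : Prop := has_ubound (variations mu).

Definition ba_pred : {pred A -> R} :=
  fun mu => `[< fin_additive mu /\ finite_variation mu >].

Record ba : Type := Ba { ba_fun :> A -> R ; _ : ba_fun \in ba_pred }.

HB.instance Definition _ := [isSub for ba_fun].
HB.instance Definition _ := [Choice of ba by <:].

Lemma variations_has_sup mu : finite_variation mu -> has_sup (variations mu).
Proof.
move=> ?; split => //; exists (`|mu \bot%O| + `|mu \bot%O|).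
by exists \bot%O, \bot%O; rewrite meetxx.
Qed.

Lemma le_variation mu (a b : A) : finite_variation mu ->
  (a `&` b = \bot)%O -> `|mu a| + `|mu b| <= variation mu.
Proof.
by move=> fmu ab; apply: ub_le_sup => //; exists a, b.
Qed.

Lemma variation_le mu (c : R) :
  (forall a b : A, (a `&` b = \bot)%O -> `|mu a| + `|mu b| <= c) ->
  variation mu <= c.
Proof.
move=> h; apply: ge_sup.
  exists (`|mu \bot%O| + `|mu \bot%O|).
  by exists \bot%O, \bot%O; rewrite meetxx.
by move=> _ [a [b [ab ->]]]; exact: h.
Qed.

Lemma variation_addr mu nu (a b : A) :
    finite_variation mu -> finite_variation nu -> (a `&` b = \bot)%O ->
  `|(mu + nu) a| + `|(mu + nu) b| <= variation mu + variation nu.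
Proof.
move=> fmu fnu ab; rewrite !fctE.
apply: (@le_trans _ _ ((`|mu a| + `|nu a|) + (`|mu b| + `|nu b|))).
  by apply: lerD; exact: ler_normD.
by rewrite addrACA lerD// le_variation.
Qed.

Lemma variation_scale (k : R) mu (a b : A) : finite_variation mu ->
  (a `&` b = \bot)%O -> `|(k *: mu) a| + `|(k *: mu) b| <= `|k| * variation mu.
Proof.
move=> fmu ab; rewrite -![(k *: mu) _]/(k * mu _) !normrM -mulrDr.
by rewrite ler_wpM2l// le_variation.
Qed.

Lemma ba_submod_closed : submod_closed ba_pred.
Proof.
split.
  apply/asboolP; split; first by move=> a b _; exact: esym (addr0 0).
  by exists 0 => _ [a [b [_ ->]]]; rewrite -![0 _]/0 normr0 addr0.
move=> k mu nu /asboolP[amu fmu] /asboolP[anu fnu]; apply/asboolP; split.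
  move=> a b ab; rewrite !fctE amu// anu// scalerDr.
  by rewrite addrACA.
exists (`|k| * variation mu + variation nu) => _ [a [b [ab ->]]].
rewrite !fctE.
apply: (@le_trans _ _ ((`|k *: mu a| + `|nu a|) + (`|k *: mu b| + `|nu b|))).
  by apply: lerD; exact: ler_normD.
by rewrite addrACA lerD//; [exact: variation_scale|exact: le_variation].
Qed.

HB.instance Definition _ := GRing.isSubmodClosed.Build R (A -> R) ba_pred
  ba_submod_closed.
HB.instance Definition _ := [SubChoice_isSubLmodule of ba by <:].

Lemma ba_additive (mu : ba) : fin_additive mu.
Proof. by case: mu => mu /= /asboolP[]. Qed.

Lemma ba_finite_variation (mu : ba) : finite_variation mu.
Proof. by case: mu => mu /= /asboolP[]. Qed.

Let ler_variationD (mu nu : ba) :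
  variation (mu + nu : ba) <= variation mu + variation nu.
Proof.
apply: variation_le => a b ab.
by apply: variation_addr => //; exact: ba_finite_variation.
Qed.

Let variationZ (k : R) (mu : ba) :
  variation (k *: mu : ba) = `|k| * variation mu.
Proof.
have le l (nu : ba) : variation (l *: nu : ba) <= `|l| * variation nu.
  apply: variation_le => a b ab.
  by apply: variation_scale => //; exact: ba_finite_variation.
apply/eqP; rewrite eq_le le /=.
have [->|k0] := eqVneq k 0.
  rewrite normr0 mul0r scale0r.
  apply: le_trans (le_variation (ba_finite_variation (0 : ba))
    (meetxx (\bot%O : A))).
  by rewrite addr_ge0.
rewrite -ler_pdivlMl ?normr_gt0// -normfV.
by have := le k^-1 (k *: mu); rewrite scalerA mulVf// scale1r.
Qed.

Let variation_eq0 (mu : ba) : variation mu = 0 -> mu = 0.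
Proof.
move=> mu0; apply: val_inj; apply/funext => a /=.
have := le_variation (ba_finite_variation mu) (meetx0 a).
rewrite mu0 => h.
apply/eqP; rewrite -normr_le0; apply: le_trans h.
by rewrite lerDl.
Qed.

HB.instance Definition _ := Lmodule_isNormed.Build R ba
  ler_variationD variationZ variation_eq0.

Lemma ba_normE (mu : ba) : `|mu| = variation mu.
Proof. by []. Qed.

End ba.

Section weak_topology.
Variables (R : realType) (V : normedModType R).

(* The topological dual of V. *)
Record dual : Type := Dual {
  dual_fun :> {linear V -> R^o} ;
  dual_continuous : continuous dual_fun }.

(* V with the coarsest topology making every element of [dual] continuous. *)
Definition weak : Type :=
  sup_topology (fun f : dual =>
    Topological.class (initial_topology (f : V -> R^o))).

HB.instance Definition _ := Topological.on weak.

Definition weak_cvg (u : nat -> V) (l : V) : Prop :=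
  (u : nat -> weak) @ \oo --> (l : weak).

Lemma weak_cvgP (u : nat -> V) (l : V) :
  weak_cvg u l <-> forall f : dual, f (u n) @[n --> \oo] --> f l.
Proof.
rewrite /weak_cvg cvg_sup; split => h f; have := h f.
  by move=> {}h U /(@initial_continuous _ _ (f : V -> R^o) l) /h.
move=> {}h U [_ [[W oW <-] fl] WU]; apply: filterS WU _.
by apply: h; exact: open_nbhs_nbhs.
Qed.

End weak_topology.

Section properties.
Variables (R : realType) (d : Order.disp_t) (A : ctbDistrLatticeType d).

Definition pointwise_null (mu : nat -> ba R A) : Prop :=
  forall a : A, mu n a @[n --> \oo] --> (0 : R).

Definition norm_bounded (mu : nat -> ba R A) : Prop :=
  exists M : R, forall n, `|mu n| <= M.

Definition Nikodym_property : Prop :=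
  forall mu : nat -> ba R A, pointwise_null mu -> norm_bounded mu.

Definition Grothendieck_property : Prop :=
  forall mu : nat -> ba R A, norm_bounded mu -> pointwise_null mu ->
    weak_cvg mu 0.

End properties.

Definition is_subalgebra (S : set (set nat)) : Prop :=
  [/\ S set0, S setT, setI_closed S, setU_closed S & setC_closed S].

Record subalgebra : Type := Subalgebra {
  carrier :> set (set nat) ;
  subalgebraP : is_subalgebra carrier }.

Section subalgebra_boolalg.
Variable S : subalgebra.

Definition subalgebra_pred : {pred set nat} := fun a => a \in carrier S.

(* The Boolean algebra whose elements are the members of S. *)
Record elements : Type := Element {
  element_val :> set nat ; _ : element_val \in subalgebra_pred }.

HB.instance Definition _ := [isSub for element_val].
HB.instance Definition _ := [Choice of elements by <:].

Let meet_closed :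
  {in subalgebra_pred &, forall a b, (a `&` b)%O \in subalgebra_pred}.
Proof.
by case: (subalgebraP S) => _ _ h _ _ a b /set_mem aS /set_mem bS;
  apply/mem_set/h.
Qed.

Let join_closed :
  {in subalgebra_pred &, forall a b, (a `|` b)%O \in subalgebra_pred}.
Proof.
by case: (subalgebraP S) => _ _ _ h _ a b /set_mem aS /set_mem bS;
  apply/mem_set/h.
Qed.

Let bot_closed : (\bot%O : set nat) \in subalgebra_pred.
Proof. by case: (subalgebraP S) => h _ _ _ _; exact/mem_set. Qed.

Let top_closed : (\top%O : set nat) \in subalgebra_pred.
Proof. by case: (subalgebraP S) => _ h _ _ _; exact/mem_set. Qed.

HB.instance Definition _ := Order.SubChoice_isTBSubLattice.Build
  set_display (set nat) subalgebra_pred set_display elements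
  meet_closed join_closed bot_closed top_closed.

Let meetUl : @left_distributive elements elements Order.meet Order.join.
Proof.
by move=> a b c; apply: val_inj; exact: setIUl.
Qed.

HB.instance Definition _ := Order.Lattice_Meet_isDistrLattice.Build
  set_display elements meetUl.

Let compl_closed (a : elements) : (~` (val a))%O \in subalgebra_pred.
Proof.
case: (subalgebraP S) => _ _ _ _ h; apply/mem_set/h.
exact: set_mem (valP a).
Qed.

Let compl (a : elements) : elements := Element (compl_closed a).

Let joinxC (a : elements) : (a `|` compl a = \top)%O.
Proof. by apply: val_inj; exact: setUCr. Qed.

Let meetxC (a : elements) : (a `&` compl a = \bot)%O.
Proof. by apply: val_inj; exact: setICr. Qed.

HB.instance Definition _ := Order.TBDistrLattice_hasComplement.Build
  set_display elements joinxC meetxC.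

Lemma element_valI (a b : elements) :
  element_val (a `&` b)%O = element_val a `&` element_val b.
Proof. by []. Qed.

Lemma element_valU (a b : elements) :
  element_val (a `|` b)%O = element_val a `|` element_val b.
Proof. by []. Qed.

Lemma element_valC (a : elements) : element_val (~` a)%O = ~` element_val a.
Proof. by []. Qed.

Lemma element_val0 : element_val \bot%O = set0.
Proof. by []. Qed.

Lemma element_val1 : element_val \top%O = setT.
Proof. by []. Qed.

End subalgebra_boolalg.

(* The characteristic functions of the members of S. *)
Definition char_set (S : set (set nat)) : set cantor_space :=
  [set x : cantor_space | S [set n | x n]].

Definition Fsigmadelta {T : topologicalType} (S : set T) : Prop :=
  exists2 F : (set T)^nat, (forall i, Fsigma (F i)) & S = \bigcap_i F i.

(* Main.v *)
(** For a set [X] of naturals let [Z X] be the ideal of the sets [A] with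
    [#|A `&` [0, n!)| / n! --> 0] as [n] runs through [X].  The algebras are
    [Z X] together with the complements of its members.

    Nikodym property: by the classical theorem for power sets, a pointwise null
    sequence of measures is uniformly bounded on the subsets of any fixed member
    of the ideal.  If it were unbounded on the whole ideal, then discarding
    initial segments and splitting into residue classes would yield members
    [B k] of density at most [2^-k] on which some measure exceeds [k]; their
    union is in the ideal, a contradiction.

    Failure of the Grothendieck property: the uniform probabilities on
    [[0, n!)] minus the point mass of the ultrafilter of complements of members
    of [Z X] are pointwise null along [X], but the sum over all singletons is a
    continuous functional equal to [1] on each of them.

    Non-isomorphism: an isomorphism is induced by a permutation of the
    naturals.  As [n!] outgrows [(n-1)!], for infinite [X `\` Y] a permutation
    can be diagonalised against.  Almost disjoint sets [X] indexed by the reals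
    [r] are obtained from the codes of the pairs [(n, floor (r n))]. *)
Require Import Defs.
From HB Require Import structures.
From mathcomp Require Import all_boot all_order all_algebra.
From mathcomp Require Import all_classical all_reals all_analysis.
From mathcomp Require Import zify lra.

Set Implicit Arguments.
Unset Strict Implicit.
Unset Printing Implicit Defensive.

Import Order.TTheory GRing.Theory Num.Theory.
Import numFieldNormedType.Exports.

Local Open Scope classical_set_scope.
Local Open Scope ring_scope.

(** * The Nikodym theorem on the power set of the naturals *)

Lemma exists_nat_gt (R : realType) (x : R) : exists k, x < k%:R.
Proof.
by exists (Num.bound `|x|); exact: le_lt_trans (ler_norm _) (archi_boundP _).
Qed.

Section Nikodym_powerset.
Variables (R : realType) (m : nat -> set nat -> R).
Hypothesis madd : forall n A B, A `&` B = set0 -> m n (A `|` B) = m n A + m n B.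
Hypothesis mbounded : forall n, exists c : R, forall A, `|m n A| <= c.
Hypothesis mpointwise : forall A, exists c : R, forall n, `|m n A| <= c.

Let unbounded E := forall c : R, exists n C, C `<=` E /\ c < `|m n C|.

Let m0 n : m n set0 = 0.
Proof.
by have := madd n (setI0 set0); rewrite setU0; lra.
Qed.

Let mD n A C : C `<=` A -> m n A = m n C + m n (A `\` C).
Proof. by move=> CA; rewrite -madd ?setDIK// setDUK. Qed.

Let unbounded_diff E C : unbounded E -> ~ unbounded (E `\` C) -> unbounded C.
Proof.
move=> uE /existsNP[c hc] c'.
have [n [D [DE hD]]] := uE (c' + c).
exists n, (D `&` C); split; first exact: subIsetr.
have hDC : `|m n (D `\` C)| <= c.
  rewrite leNgt; apply/negP => h; apply: hc; exists n, (D `\` C).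
  by split => // x [? ?]; split => //; exact: DE.
have := mD n (@subIsetl _ D C); rewrite setDIr setDv set0U => e.
have := ler_normD (m n (D `&` C)) (m n (D `\` C)); rewrite -e; lra.
Qed.

(** If [M] bounds all values at [E], then [|m n C| > p + M] forces both [C] and [E \ C] to have
    value above [p]. One of the two is still unbounded; the other serves as [D]. *)
Let peel E p : unbounded E ->
  exists n D, [/\ D `<=` E, p < `|m n D| & unbounded (E `\` D)].
Proof.
move=> uE; have [M hM] := mpointwise E.
have [n [C [CE hC]]] := uE (p + M).
have M0 : 0 <= M by apply: le_trans (hM 0%N).
case: (pselect (unbounded (E `\` C))) => [u|nu].
  by exists n, C; split => //; lra.
exists n, (E `\` C); split; first by move=> x [].
  have := ler_normB (m n E) (m n (E `\` C)); have := hM n.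
  by rewrite {2}(mD n CE) addrK; lra.
rewrite setDD setIidr//; exact: unbounded_diff nu.
Qed.

(** Iterated peeling yields disjoint pieces [D k] on which some measure exceeds [k]. The unions of
    the even and of the odd pieces are the two halves. *)
Let split_unbounded E : unbounded E -> exists E0 E1,
  [/\ E0 `<=` E, E1 `<=` E, E0 `&` E1 = set0, unbounded E0 & unbounded E1].
Proof.
move=> uE.
have /choice[f hf] : forall q : nat * set nat, exists r : nat * set nat,
    unbounded q.2 ->
    [/\ r.2 `<=` q.2, q.1%:R < `|m r.1 r.2| & unbounded (q.2 `\` r.2)].
  move=> [k F]; case: (pselect (unbounded F)) => [uF|?].
    by have [n [D ?]] := peel k%:R uF; exists (n, D).
  by exists (0%N, set0).
pose Es := fix Es k := if k is j.+1 then Es j `\` (f (j, Es j)).2 else E.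
pose D k := (f (k, Es k)).2.
have uEs k : unbounded (Es k).
  by elim: k => //= k /(hf (k, _))[].
have DEs k : D k `<=` Es k by have [] := hf (k, Es k) (uEs k).
have Es_dec i k : Es (i + k)%N `<=` Es i.
  by elim: k => [|k IH]; rewrite ?addn0// addnS /= => x [/IH].
have Ddisj i k x : (i < k)%N -> D i x -> D k x -> False.
  move=> ik Di /DEs; rewrite -(subnKC ik) => /Es_dec /= [_]; exact.
have DE k : D k `<=` E by move=> x /DEs; exact: (Es_dec 0%N).
have uni g : (forall k, (k <= g k)%N) -> unbounded (\bigcup_k D (g k)).
  move=> gk c; have [k ck] := exists_nat_gt c.
  exists (f (g k, Es (g k))).1, (D (g k)).
  split; first by move=> x Dx; exists k.
  have [_ + _] := hf (g k, Es (g k)) (uEs (g k)); apply: lt_trans.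
  by apply: (lt_le_trans ck); rewrite ler_nat.
exists (\bigcup_k D k.*2), (\bigcup_k D k.*2.+1); split.
- by move=> x [k _ /DE].
- by move=> x [k _ /DE].
- apply/seteqP; split => // x [[k _ Dk] [l _ Dl]].
  have [kl|] := ltnP k.*2 l.*2.+1; first exact: Ddisj kl Dk Dl.
  rewrite leq_eqVlt => /orP[/eqP e|kl]; last exact: Ddisj kl Dl Dk.
  lia.
- by apply: uni => k; lia.
- by apply: uni => k; lia.
Qed.

(** The least such [c] is the total variation of [m n] on [E], expressed without absolute values so
    that pairs add up. *)
Let osc n E c := forall C D, C `<=` E -> D `<=` E -> C `&` D = set0 ->
  m n C - m n D <= c.

(* The oscillation is superadditive over disjoint sets, so one of two disjoint
   unbounded subsets has at most half of it. *)
Let halve_osc n E c : unbounded E -> osc n E c ->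
  exists E', [/\ E' `<=` E, unbounded E' & osc n E' (c / 2)].
Proof.
move=> /split_unbounded[E0 [E1 [E0E E1E E01 u0 u1]]] oE.
case: (pselect (osc n E0 (c / 2))) => [h0|n0]; first by exists E0.
exists E1; split => // C1 D1 C1E D1E CD1; rewrite leNgt; apply/negP => h1.
apply: n0 => C0 D0 C0E D0E CD0; rewrite leNgt; apply/negP => h0.
have dis x : E0 x -> E1 x -> False.
  by move=> ? ?; suff: set0 x by []; rewrite -E01.
have dis0 (A B : set nat) : A `<=` E0 -> B `<=` E1 -> A `&` B = set0.
  by move=> AE BE; apply/seteqP; split => // x [/AE + /BE]; exact: dis.
have := oE (C0 `|` C1) (D0 `|` D1).
rewrite !madd; [|exact: dis0|exact: dis0].
have -> : (C0 `|` C1) `&` (D0 `|` D1) = set0.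
  by rewrite setIUl !setIUr CD0 CD1 (dis0 C0)// (setIC C1) (dis0 D0)// !setU0.
have UE (A B : set nat) : A `<=` E0 -> B `<=` E1 -> A `|` B `<=` E.
  by move=> AE BE x [/AE/E0E|/BE/E1E].
by move=> /(_ (UE _ _ C0E C1E) (UE _ _ D0E D1E) erefl); lra.
Qed.

(** Starting from an oscillation of at most [2 ^+ k], [k] halvings bring it down to 1. The pairs
    [(C, set0)] and [(set0, C)] then bound both signs of [m n C]. *)
Let small_unbounded n E : unbounded E ->
  exists E', [/\ E' `<=` E, unbounded E' & forall C, C `<=` E' -> `|m n C| <= 1].
Proof.
have [c hc] := mbounded n.
have : osc n E (c + c).
  move=> C D _ _ _; have := hc C; have := hc D.
  have := ler_norm (m n C); have := ler_norm (- m n D); rewrite normrN; lra.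
have [k ck] := exists_nat_gt (c + c).
have : c + c <= 2 ^+ k.
  by apply/ltW/(lt_trans ck); rewrite -natrX ltr_nat ltn_expl.
move: (c + c) ck => {hc}c _.
elim: k c E => [|k IH] c E ck oE uE.
  exists E; split => // C CE.
  rewrite expr0 in ck.
  have := oE C set0 CE (sub0set _) (setI0 _).
  have := oE set0 C (sub0set _) CE (set0I _).
  by rewrite m0 ler_norml; lra.
have [E1 [E1E u1 o1]] := halve_osc uE oE.
have [|E2 [E21 u2 h2]] := IH (c / 2) E1 _ o1 u1.
  by move: ck; rewrite exprS; lra.
by exists E2; split => //; exact: subset_trans E1E.
Qed.

(** A gliding hump. Stage [k] keeps the union [U k] of the pieces chosen so far and an unbounded
    reservoir [E k]. The new piece [D k] outweighs [U k] by more than [k + 1] for the measure [n k],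
    which is at most 1 on the next reservoir. On the union [V] of all pieces the measure [n k]
    therefore exceeds [k]. *)
Theorem Nikodym_powerset : exists c : R, forall n A, `|m n A| <= c.
Proof.
case: (pselect (unbounded setT)) => [uT|/existsNP[c hc]]; last first.
  exists c => n A; rewrite leNgt; apply/negP => h; apply: hc.
  by exists n, A.
have /choice[f hf] : forall q : nat * (set nat * set nat),
    exists r : nat * (set nat * set nat),
    unbounded q.2.2 ->
    [/\ r.2.1 `<=` q.2.2, r.2.2 `<=` q.2.2 `\` r.2.1, unbounded r.2.2,
        q.1%:R + 1 + `|m r.1 q.2.1| < `|m r.1 r.2.1| &
        forall C, C `<=` r.2.2 -> `|m r.1 C| <= 1].
  move=> [k [U E]] /=; case: (pselect (unbounded E)) => [uE|?]; last first.
    by exists (0%N, (set0, set0)).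
  (* [M] bounds the values at [U] for every index, so the threshold can be fixed before [peel]
     supplies [n]. *)
  have [M hM] := mpointwise U.
  have [n [D [DE hD uED]]] := peel (k%:R + 1 + M) uE.
  have [E' [E'E uE' hE']] := small_unbounded n uED.
  exists (n, (D, E')) => _; split => //=.
  by apply: le_lt_trans hD; rewrite lerD2l.
pose st := fix st k := if k is j.+1 then
  let r := f (j, st j) in ((st j).1 `|` r.2.1, r.2.2) else (set0, setT).
pose U k := (st k).1; pose E k := (st k).2.
pose n k := (f (k, st k)).1; pose D k := (f (k, st k)).2.1.
have uE k : unbounded (E k) by elim: k => //= k /(hf (k, _))[].
have US k : U k.+1 = U k `|` D k by [].
have DE k : D k `<=` E k by have [] := hf (k, st k) (uE k).
have ES k : E k.+1 `<=` E k `\` D k by have [] := hf (k, st k) (uE k).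
have hD k : k%:R + 1 + `|m (n k) (U k)| < `|m (n k) (D k)|.
  by have [] := hf (k, st k) (uE k).
have hE k C : C `<=` E k.+1 -> `|m (n k) C| <= 1.
  by have [_ _ _ _ h] := hf (k, st k) (uE k); exact: h.
have UE k : U k `&` E k = set0.
  elim: k => [|k IH]; first by rewrite /U set0I.
  apply/seteqP; split => // x; rewrite US => -[[Ux|Dx] /ES[Ex nDx]] //.
  by rewrite -IH.
have Ule i k : U (i + k)%N `<=` U i `|` E i.
  have Ele j : E (i + j)%N `<=` E i.
    by elim: j => [|j IH]; rewrite ?addn0// addnS => x /ES[/IH].
  elim: k => [|k IH]; first by rewrite addn0; exact: subsetUl.
  by rewrite addnS US subUset; split => // x /DE /Ele; right.
have Umono i k : U i `<=` U (i + k)%N.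
  by elim: k => [|k IH]; rewrite ?addn0// addnS US => x /IH; left.
pose V := \bigcup_k U k.
have [M hM] := mpointwise V.
have [k Mk] := exists_nat_gt M.
have UV : U k.+1 `<=` V by move=> x Ux; exists k.+1.
(* All later pieces come from the reservoir [E k.+1], where the measure [n k] is at most 1. *)
have VE : V `\` U k.+1 `<=` E k.+1.
  move=> x [[j _ Ujx] nUx].
  have : U (k.+1 + j)%N x by rewrite addnC; exact: Umono.
  by move=> /Ule[].
have UD : U k `&` D k = set0.
  by apply/seteqP; split => // x [Ux /DE Ex]; rewrite -(UE k).
have := mD (n k) UV; rewrite US madd// => e.
have := hE k _ VE; have := hM (n k); have := hD k.
rewrite US; move: Mk e; move: (m _ (V `\` _)) (m _ V) (m _ (U _)) (m _ (D _)) k%:R.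
move=> w v u d r Mr e; have -> : d = v - (u + w) by lra.
by have := ler_normB v (u + w); have := ler_normD u w; lra.
Qed.

End Nikodym_powerset.

(** * The density ideals *)

Definition cnt (A : set nat) N := count (fun i => `[< A i >]) (iota 0 N).

Lemma cntS A N : cnt A N.+1 = (cnt A N + `[< A N >])%N.
Proof. by rewrite /cnt -addn1 iotaD count_cat /= addn0. Qed.

Lemma sub_cnt_lt A B N : (forall i, (i < N)%N -> A i -> B i) ->
  (cnt A N <= cnt B N)%N.
Proof.
elim: N => // N IH AB; rewrite !cntS leq_add ?IH//.
  by move=> i iN; apply: AB; exact: ltnW.
by case: asboolP => // /AB BN; case: asboolP => // -[]; exact: BN.
Qed.

Lemma sub_cnt A B N : A `<=` B -> (cnt A N <= cnt B N)%N.
Proof. by move=> AB; apply: sub_cnt_lt => i _ /AB. Qed.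

Lemma cntU A B N : (cnt (A `|` B) N <= cnt A N + cnt B N)%N.
Proof.
elim: N => // N; rewrite !cntS.
by case: asboolP => [[] ?|nAB]; case: asboolP => ?; case: asboolP => ? //; lia.
Qed.

Lemma cntUI A B N : A `&` B = set0 -> cnt (A `|` B) N = (cnt A N + cnt B N)%N.
Proof.
move=> AB; elim: N => // N; rewrite !cntS asbool_or.
have : ~ (A N /\ B N) by move=> ABN; suff: set0 N by []; rewrite -AB.
by case: asboolP => ?; case: asboolP => ? nAB /=; [case: nAB|lia..].
Qed.

Lemma cntC A N : (cnt A N + cnt (~` A) N = N)%N.
Proof.
elim: N => // N; rewrite !cntS.
by case: asboolP => ?; case: asboolP => ? //; lia.
Qed.

Lemma cnt_le A N : (cnt A N <= N)%N.
Proof. by rewrite -[leqRHS](cntC A) leq_addr. Qed.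

Lemma cnt_bounded A M N : A `<=` `I_M -> (cnt A N <= M)%N.
Proof.
move=> AM; rewrite /cnt -size_filter -[leqRHS](size_iota 0).
apply: uniq_leq_size; first by rewrite filter_uniq// iota_uniq.
by move=> i; rewrite mem_filter !mem_iota => /andP[/asboolP/AM].
Qed.

Lemma cnt0 A M N : (forall i, A i -> (M <= i)%N) -> (N <= M)%N -> cnt A N = 0%N.
Proof.
move=> AM NM; apply/eqP; rewrite -leqn0 leqNgt -has_count; apply/hasPn => i.
by rewrite mem_iota => /= iN; apply/asboolPn => /AM; lia.
Qed.

Lemma cnt_inj_bounded (p : nat -> nat) A M N : injective p ->
  (forall i, A i -> (p i < M)%N) -> (cnt A N <= M)%N.
Proof.
move=> pI AM; rewrite /cnt -size_filter -(size_map p) -[leqRHS](size_iota 0).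
apply: uniq_leq_size; first by rewrite map_inj_uniq// filter_uniq// iota_uniq.
move=> _ /mapP[i + ->]; rewrite mem_filter => /andP[/asboolP/AM ? _].
by rewrite mem_iota.
Qed.

Lemma cnt_image_bounded (p : nat -> nat) A M N : A `<=` p @` `I_M ->
  (cnt A N <= M)%N.
Proof.
move=> AM; rewrite /cnt -size_filter -[leqRHS](size_iota 0) -[leqRHS](size_map p).
apply: uniq_leq_size; first by rewrite filter_uniq// iota_uniq.
move=> i; rewrite mem_filter => /andP[/asboolP/AM[j jM <-] _].
by apply: map_f; rewrite mem_iota.
Qed.

Definition residue_class d r := [set i | (i %% d)%N = r].

(** The summand [r] carries the induction: at [N = q * d + r] the bound says exactly that at most
    [q] elements were counted so far. *)
Lemma cnt_residue_class d r N : (r < d)%N ->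
  (d * cnt (residue_class d r) N + r < N + d)%N.
Proof.
move=> rd; elim: N => [|N IH]; first by rewrite muln0 add0n.
rewrite cntS; case: asboolP => [|_]; last by rewrite addn0; lia.
rewrite /residue_class /= => e.
have := divn_eq N d; rewrite e => {}e.
have : (cnt (residue_class d r) N <= N %/ d)%N.
  by rewrite -ltnS -(ltn_pmul2l (leq_trans (ltn0Sn _) rd)) mulnS; lia.
by rewrite addn1 mulnS; move: (cnt _ _) => c ?; nia.
Qed.

(** Up to [M] nothing is counted; beyond it the additive error [d] is below [N], whence the factor
    2. *)
Lemma cnt_residue_class_tail d r M N A : (r < d)%N -> (d <= M)%N ->
  (forall i, A i -> (M <= i)%N) -> A `<=` residue_class d r ->
  (d * cnt A N <= 2 * N)%N.
Proof.
move=> rd dM AM Ar; have [NM|MN] := leqP N M; first by rewrite (cnt0 AM NM) muln0.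
have := cnt_residue_class N rd; have := sub_cnt N Ar.
move: (cnt _ _) (cnt _ _) => a b ab h.
have : (d * b <= d * a)%N by rewrite leq_mul2l ab orbT.
lia.
Qed.

Lemma cnt_even N : (N <= 2 * cnt [set i | ~~ odd i] N <= N.+1)%N.
Proof.
suff : (2 * cnt [set i | ~~ odd i] N = N + odd N)%N by case: odd => ->; lia.
by elim: N => // N; rewrite cntS; case: asboolP => /=; case: odd => //=; lia.
Qed.

(** The ideal [Z X], with [1 / k] as the epsilon and denominators cleared so that densities are
    handled in integer arithmetic. *)
Definition density_zero (X A : set nat) := forall k, exists m,
  forall n, (m <= n)%N -> X n -> (k * cnt A n`! <= n`!)%N.

Section density_zero_ideal.
Variable X : set nat.

Lemma sub_density_zero A B : A `<=` B -> density_zero X B -> density_zero X A.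
Proof.
move=> AB ZB k; have [m hm] := ZB k; exists m => n mn Xn.
by apply: leq_trans (hm n mn Xn); rewrite leq_mul2l sub_cnt// orbT.
Qed.

Lemma density_zeroU A B :
  density_zero X A -> density_zero X B -> density_zero X (A `|` B).
Proof.
move=> ZA ZB k; have [m1 h1] := ZA (2 * k)%N; have [m2 h2] := ZB (2 * k)%N.
exists (maxn m1 m2) => n; rewrite geq_max => /andP[/h1{}h1 /h2{}h2] Xn.
have := leq_mul (leqnn k) (cntU A B n`!); have := h1 Xn; have := h2 Xn; lia.
Qed.

Lemma density_zero_finite A M : A `<=` `I_M -> density_zero X A.
Proof.
move=> AM k; exists (k * M)%N => n kMn _.
apply: leq_trans (leq_trans kMn _); last exact: fact_geq.
by rewrite leq_mul2l (cnt_bounded _ AM) orbT.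
Qed.

(** A finite union of the [B l] is in the ideal, and the remaining ones have total density at most a
    geometric tail. Since [B l] starts at [l], only finitely many of them meet the numbers below
    [n]!. *)
Lemma density_zero_bigcup (B : nat -> set nat) :
    (forall k, density_zero X (B k)) -> (forall k i, B k i -> (k <= i)%N) ->
    (forall k N, (2 ^ k * cnt (B k) N <= N)%N) ->
  density_zero X (\bigcup_k B k).
Proof.
move=> ZB Bk Bsmall k.
pose Bi i j := \bigcup_(l in [set l | i <= l < i + j]%N) B l.
have BiS i j : Bi i j.+1 `<=` B i `|` Bi i.+1 j.
  move=> x [l /= + Blx]; rewrite leq_eqVlt => /andP[/orP[/eqP il|il] ?].
    by left; rewrite il.
  by right; exists l => //=; lia.
have Bi0 i N : cnt (Bi i 0%N) N = 0%N.
  by apply: (@cnt0 _ N) => // x [l /=]; lia.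
have Bicnt i j N : (2 ^ i * cnt (Bi i j) N <= 2 * N)%N.
  elim: j i => [|j IH] i; first by rewrite Bi0 muln0.
  have := leq_trans (sub_cnt N (BiS i j)) (cntU _ _ _).
  have := Bsmall i N; have := IH i.+1; rewrite expnS.
  move: (cnt _ _) (cnt _ _) (cnt _ _) (2 ^ i)%N => a b c e; nia.
have ZBi j : density_zero X (Bi 0%N j).
  elim: j => [|j IH].
    by move=> l; exists 0%N => n _ _; rewrite Bi0 muln0.
  apply: (sub_density_zero _ (density_zeroU IH (ZB j))) => x [l /=]; rewrite !add0n.
  rewrite ltnS leq_eqVlt => /orP[/eqP->|lj] Bx; first by right.
  by left; exists l.
(* Head and tail each get half of the allowed density [1 / k]; cutting at [4 * k] suffices for the
   tail because [4 * k <= 2 ^ (4 * k)]. *)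
have [m hm] := ZBi (4 * k)%N (2 * k)%N.
exists m => n mn Xn.
have sub : \bigcup_k B k `&` `I_n`! `<=` Bi 0%N (4 * k)%N `|` Bi (4 * k)%N n`!.
  move=> x [[l _ Blx] /= xn]; have lx := Bk _ _ Blx.
  by have [l4|l4] := ltnP l (4 * k); [left|right]; exists l => //=; lia.
have : (cnt (\bigcup_k B k) n`! <= cnt (Bi 0 (4 * k)) n`! + cnt (Bi (4 * k) n`!) n`!)%N.
  apply: leq_trans (leq_trans (sub_cnt n`! sub) (cntU _ _ _)).
  exact: sub_cnt_lt.
have := hm n mn Xn; have := Bicnt (4 * k)%N n`! n`!.
have : (4 * k <= 2 ^ (4 * k))%N by apply: ltnW; rewrite ltn_expl.
move: (cnt _ _) (cnt _ _) (cnt _ _) (2 ^ _)%N => a b c e; nia.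
Qed.

End density_zero_ideal.

Lemma infinite_density_zeroC (X A : set nat) :
  (forall N, exists2 n, (N <= n)%N & X n) ->
  density_zero X A -> ~ density_zero X (~` A).
Proof.
move=> Xinf ZA ZC; have [m1 h1] := ZA 3%N; have [m2 h2] := ZC 3%N.
have [n] := Xinf (maxn m1 m2); rewrite geq_max => /andP[/h1{}h1 /h2{}h2] Xn.
by have := h1 Xn; have := h2 Xn; have := cntC A n`!; have := fact_gt0 n; lia.
Qed.

(** * Uniform boundedness on a density ideal *)

Section Nikodym_density_zero.
Variables (R : realType) (X : set nat) (m : nat -> set nat -> R).
Local Notation Z := (density_zero X).
Hypothesis madd : forall n A B, Z A -> Z B -> A `&` B = set0 ->
  m n (A `|` B) = m n A + m n B.
Hypothesis mbounded : forall n, exists c : R, forall A, Z A -> `|m n A| <= c.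
Hypothesis mpointwise : forall A, Z A -> exists c : R, forall n, `|m n A| <= c.

(** The trace [C & B] of any set of naturals is in the ideal, so evaluating [m n] at traces gives
    measures on the whole power set. *)
Let bounded_below B : Z B ->
  exists c : R, forall n C, C `<=` B -> `|m n C| <= c.
Proof.
move=> ZB; have ZI C : Z (C `&` B) by exact: sub_density_zero ZB.
have [||A|c hc] := @Nikodym_powerset R (fun n C => m n (C `&` B)).
- move=> n C D CD; rewrite setIUl madd//.
  by rewrite setIACA CD set0I.
- by move=> n; have [c hc] := mbounded n; exists c => A; exact: hc.
- exact: mpointwise.
by exists c => n C CB; have := hc n C; rewrite (setIidl CB).
Qed.

Let mD n A C : Z A -> m n A = m n (A `&` C) + m n (A `\` C).
Proof.
move=> ZA; rewrite -madd ?setUIDK//; try exact: sub_density_zero ZA.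
by apply/seteqP; split => // x [[_ ?] []].
Qed.

(* Discarding an initial segment costs a bounded amount, and one of the d
   residue classes of what remains carries a d-th part of the value. *)
Let small_set k : (forall c : R, exists n A, Z A /\ c < `|m n A|) ->
  exists n B, [/\ Z B, forall i, B i -> (k <= i)%N,
    forall N, (2 ^ k * cnt B N <= N)%N & k%:R < `|m n B|].
Proof.
(* The exponent [k.+1] absorbs the factor 2 of [cnt_residue_class_tail], which needs [d <= M]. The
   threshold below pays [c] for the initial segment and [k] for each of the [d] classes. *)
move=> unb; pose d := (2 ^ k.+1)%N; pose M := maxn k d.
have [c hc] := bounded_below (@density_zero_finite X `I_M M (@subset_refl _ _)).
have [n [A [ZA hA]]] := unb (c + d%:R * k%:R).
pose A' := A `\` `I_M.
have ZA' : Z A' by apply: sub_density_zero ZA => x [].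
have A'M i : A' i -> (M <= i)%N by move=> [_ /negP]; rewrite -leqNgt.
have hA' : d%:R * k%:R < `|m n A'|.
  have := hc n (A `&` `I_M) (@subIsetr _ _ _).
  by have := ler_normD (m n (A `&` `I_M)) (m n A'); rewrite -(mD n `I_M ZA); lra.
suff [r rd hr] : exists2 r, (r < d)%N & k%:R < `|m n (A' `&` residue_class d r)|.
  exists n, (A' `&` residue_class d r); split => //.
  - exact: sub_density_zero ZA'.
  - by move=> i [/A'M + _]; rewrite geq_max => /andP[].
  - move=> N; have := @cnt_residue_class_tail d r M N (A' `&` residue_class d r) rd.
    rewrite leq_maxr => /(_ isT) h.
    have {h} : (d * cnt (A' `&` residue_class d r) N <= 2 * N)%N.
      by apply: h => [i [/A'M]|i []].
    by rewrite /d expnS -mulnA leq_pmul2l.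
apply: contrapT => nex.
(* If no class exceeded [k], the first [r] classes would carry at most [r * k] together; [r = d]
   contradicts [hA']. *)
have hle r : (r <= d)%N ->
    `|m n (A' `&` [set i | (i %% d < r)%N])| <= r%:R * k%:R.
  elim: r => [_|r IH rd].
    have -> : A' `&` [set i | (i %% d < 0)%N] = set0.
      by apply/seteqP; split => // x [].
    have : m n (set0 `|` set0) = m n set0 + m n set0.
      by apply: madd; rewrite ?set0I//; apply: (@density_zero_finite _ _ 0%N).
    by rewrite setU0 mul0r normr_le0 => e; apply/eqP; lra.
  have -> : A' `&` [set i | (i %% d < r.+1)%N] =
      (A' `&` [set i | (i %% d < r)%N]) `|` (A' `&` residue_class d r).
    rewrite -setIUr; congr setI; apply/seteqP; split => i /=.
      by rewrite ltnS leq_eqVlt => /orP[/eqP|]; [right|left].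
    by rewrite ltnS => -[/ltnW|->].
  rewrite madd; try exact: sub_density_zero ZA'; last first.
    by apply/seteqP; split => // i [[_ /= +] [_ /= e]]; rewrite e ltnn.
  have : `|m n (A' `&` residue_class d r)| <= k%:R.
    by rewrite leNgt; apply/negP => h; apply: nex; exists r.
  have := IH (ltnW rd); rewrite -[r.+1]addn1 natrD mulrDl mul1r.
  by move=> h1 h2; apply: le_trans (ler_normD _ _) _; exact: lerD.
have := hle d (leqnn d).
rewrite (_ : [set i | _] = setT) ?setIT; last first.
  by apply/seteqP; split => // i _ /=; rewrite ltn_mod expn_gt0.
by move=> /(lt_le_trans hA'); rewrite ltxx.
Qed.

Theorem Nikodym_density_zero :
  exists c : R, forall n A, Z A -> `|m n A| <= c.
Proof.
apply: contrapT => nex.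
have unb (c : R) : exists n A, Z A /\ c < `|m n A|.
  apply: contrapT => h; apply: nex; exists c => n A ZA.
  by rewrite leNgt; apply/negP => hA; apply: h; exists n, A.
have /choice[n /choice[B hB]] := fun k => small_set k unb.
have ZB : Z (\bigcup_k B k).
  by apply: density_zero_bigcup => k; have [] := hB k.
have [c hc] := bounded_below ZB; have [k ck] := exists_nat_gt c.
have [_ _ _ kB] := hB k.
have /(hc (n k)) : B k `<=` \bigcup_k B k by move=> x Bx; exists k.
by move=> /(lt_le_trans kB) /(lt_trans ck); rewrite ltxx.
Qed.

End Nikodym_density_zero.

(** * The algebras *)

Definition density_alg (X : set nat) : set (set nat) :=
  [set A | density_zero X A \/ density_zero X (~` A)].

Lemma density_alg_is_subalgebra X : is_subalgebra (density_alg X).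
Proof.
have Z0 : density_zero X set0 by exact: (@density_zero_finite _ _ 0%N).
have sub := @sub_density_zero X; have ZU := @density_zeroU X.
split.
- by left.
- by right; rewrite setCT.
- move=> A B [ZA|ZA]; first by left; exact: sub ZA.
  move=> [ZB|ZB]; first by left; exact: sub ZB.
  by right; rewrite setCI; exact: ZU.
- move=> A B [ZA|ZA]; last by right; rewrite setCU; exact: sub ZA.
  move=> [ZB|ZB]; last by right; rewrite setCU; exact: sub ZB.
  by left; exact: ZU.
- by move=> A [ZA|ZA]; [right; rewrite setCK|left].
Qed.

Definition density_algebra X := Subalgebra (density_alg_is_subalgebra X).

(** * The Nikodym property of the algebras *)

Section zero_extension.
Variables (R : realType) (S : subalgebra).

(** Turns a measure on [elements S] into a function of arbitrary sets of naturals, the form used for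
    the ideals, so that membership proofs need not be carried along. *)
Definition zero_extension (mu : elements S -> R) (A : set nat) : R :=
  if pselect (carrier S A) is left h then mu (Element (mem_set h)) else 0.

Lemma zero_extensionE mu (a : elements S) : zero_extension mu (element_val a) = mu a.
Proof.
rewrite /zero_extension; case: pselect => [h|[]]; last exact: set_mem (valP a).
by congr mu; exact: val_inj.
Qed.

Lemma zero_extensionD (mu : elements S -> R) A B : fin_additive mu ->
  carrier S A -> carrier S B -> A `&` B = set0 ->
  zero_extension mu (A `|` B) = zero_extension mu A + zero_extension mu B.
Proof.
move=> amu SA SB AB; pose a := Element (mem_set SA); pose b := Element (mem_set SB).
rewrite -[A `|` B]/(element_val (a `|` b)%O) -[A]/(element_val a) -[B]/(element_val b).
by rewrite !zero_extensionE amu//; exact: val_inj.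
Qed.

End zero_extension.

Lemma ba_le_norm (R : realType) (d : Order.disp_t) (A : ctbDistrLatticeType d)
  (mu : ba R A) a : `|mu a| <= `|mu|.
Proof.
have := Defs.le_variation (ba_finite_variation mu) (meetx0 a).
by apply: le_trans; rewrite lerDl.
Qed.

(** The ideal is covered by [Nikodym_density_zero]. Any other element has its complement in the
    ideal, and the values at [\top] are bounded by pointwise convergence. *)
Lemma density_algebra_Nikodym (R : realType) X :
  Nikodym_property R (elements (density_algebra X)).
Proof.
move=> mu mu0.
have pw a : exists c : R, forall n, `|mu n a| <= c.
  have [M [_ hM]] := cvg_seq_bounded (cvgP _ (mu0 a)).
  by exists (M + 1) => n; apply: (hM (M + 1)) => //; rewrite ltrDl.
have [|||c hc] := @Nikodym_density_zero R X (fun n => zero_extension (mu n)).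
- move=> n A B ZA ZB; apply: zero_extensionD; first exact: ba_additive.
    by left.
  by left.
- move=> n; exists `|mu n| => A ZA.
  have SA : carrier (density_algebra X) A by left.
  by rewrite -[A]/(element_val (Element (mem_set SA))) zero_extensionE; exact: ba_le_norm.
- move=> A ZA; have SA : carrier (density_algebra X) A by left.
  have [c hc] := pw (Element (mem_set SA)); exists c => n.
  by rewrite -[A]/(element_val (Element (mem_set SA))) zero_extensionE.
have [M hM] := pw \top%O.
have c0 : 0 <= c.
  by apply: le_trans (hc 0%N set0 _) => //; exact: (@density_zero_finite _ _ 0%N).
have M0 : 0 <= M by apply: le_trans (hM 0%N).
have bd n a : `|mu n a| <= c + M.
  have [Za|Za] : carrier (density_algebra X) (element_val a) by exact: set_mem (valP a).
    by have := hc n _ Za; rewrite zero_extensionE; lra.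
  have := hc n _ Za; rewrite -element_valC zero_extensionE => h.
  have := ba_additive (mu n) (Order.CTBDistrLatticeTheory.meetxC a).
  rewrite Order.CTBDistrLatticeTheory.joinxC => e.
  have := ler_normB (mu n \top%O) (mu n (~` a)%O); have := hM n.
  by rewrite {2}e addrK; lra.
exists ((c + M) + (c + M)) => n; rewrite ba_normE; apply: Defs.variation_le => a b _.
exact: lerD.
Qed.

(** * The Borel class of the algebras *)

Lemma cantor_space_near (x : cantor_space) N :
  \forall y \near x, forall i, (i < N)%N -> y i = x i.
Proof.
elim: N => [|N IH]; first exact: filterE.
have xN : nbhs x [set y : cantor_space | y N = x N].
  apply: (@proj_continuous nat (fun=> bool) N x [set x N]).
  exact: discrete_set1.
move: IH xN; apply: filterS2 => y h yN i; rewrite ltnS leq_eqVlt => /orP[/eqP->|]//.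
exact: h.
Qed.

(** Each inequality depends only on the coordinates below [n]!. The bit [c] selects between the set
    coded by [x] and its complement. *)
Lemma closed_cnt_le (X : set nat) (c : bool) k m :
  closed [set x : cantor_space | forall n, (m <= n)%N -> X n ->
    (k * cnt [set i | c (+) x i] n`! <= n`!)%N].
Proof.
move=> x cx n mn Xn.
have [y [hy xy]] := cx _ (cantor_space_near x n`!).
apply: leq_trans (hy n mn Xn); rewrite leq_mul2l; apply/orP; right.
by apply: sub_cnt_lt => i /xy /= ->.
Qed.

Lemma density_algebra_Fsigmadelta X : Fsigmadelta (char_set (density_algebra X)).
Proof.
pose C (c : bool) k m := [set x : cantor_space | forall n, (m <= n)%N -> X n ->
    (k * cnt [set i | c (+) x i] n`! <= n`!)%N].
exists (fun k => \bigcup_m (C false k m `|` C true k m)).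
  move=> k; exists (fun m => C false k m `|` C true k m) => // m.
  by apply: closedU; exact: closed_cnt_le.
have CE (x : cantor_space) : [set i | true (+) x i] = ~` [set i | x i].
  by apply/seteqP; split => i /=; [move/negP|move=> /negP].
apply/seteqP; split => [x [Zx k _|Zx k _]|x Cx].
- by have [m hm] := Zx k; exists m => //; left.
- by have [m hm] := Zx k; exists m => //; right; rewrite /C/= CE.
(* The choice between the set and its complement may vary with [k]. If both alternatives failed, at
   [k1] and at [k2], then neither could hold at their maximum. *)
apply: contrapT => /not_orP[/existsNP[k1 h1] /existsNP[k2 h2]].
have [m _ [h|h]] := Cx (maxn k1 k2) I.
  apply: h1; exists m => n mn Xn; apply: leq_trans (h n mn Xn).
  by rewrite leq_mul2r leq_maxl orbT.
apply: h2; exists m => n mn Xn; apply: leq_trans (h n mn Xn).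
by rewrite CE leq_mul2r leq_maxr orbT.
Qed.

(** * Failure of the Grothendieck property *)

Section sum_over_atoms.
Variables (R : realType) (X : set nat).
Local Notation S := (density_algebra X).
Local Notation V := (ba R (elements S)).

Let finS A N : A `<=` `I_N -> carrier S A.
Proof. by move=> AN; left; exact: density_zero_finite AN. Qed.

Let SI N : carrier S `I_N. Proof. exact: (@finS _ N). Qed.

Let IS N : `I_N.+1 = `I_N `|` [set N].
Proof.
apply/seteqP; split => i /=; rewrite ltnS; last by move=> [/ltnW|->].
by rewrite leq_eqVlt => /orP[/eqP|]; [right|left].
Qed.

Let INdisj N A : A `<=` `I_N -> A `&` [set N] = set0.
Proof.
by move=> AN; apply/seteqP; split => // i [/AN /= + e]; rewrite e ltnn.
Qed.

Let sub1 N : [set N] `<=` `I_N.+1. Proof. by move=> _ -> /=. Qed.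

Let subS N A : A `<=` `I_N -> A `<=` `I_N.+1.
Proof. by move=> AN i /AN /= /ltnW; rewrite ltnS. Qed.

(** The series of the values at singletons converges absolutely: collecting the points of
    nonnegative value in [P] and the others in [Q], its partial sums of absolute values are
    [m P - m Q], bounded by the variation. *)
Let initial_cvg (mu : V) : cvgn (fun N => zero_extension mu `I_N).
Proof.
pose m := zero_extension mu.
have mD A B : carrier S A -> carrier S B -> A `&` B = set0 -> m (A `|` B) = m A + m B.
  by apply: zero_extensionD; exact: ba_additive.
have m0 : m set0 = 0.
  have S0 : carrier S set0 by exact: (@finS _ 0%N).
  by have := mD _ _ S0 S0 (setI0 _); rewrite setU0; lra.
have -> : (fun N => m `I_N) = series (fun i => m [set i]).
  apply/funext => N; rewrite /series /=; elim: N => [|N IH].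
    by rewrite big_geq// II0.
  by rewrite big_nat_recr//= -IH IS mD//; [exact: finS (@sub1 N)|exact: INdisj].
apply: (@normed_cvg R R^o); apply: nondecreasing_is_cvgn.
  by apply: nondecreasing_series => *; exact: normr_ge0.
exists `|mu| => _ [N _ <-]; rewrite /normed_series_of /series /=.
suff [P [Q [PN QN PQ ->]]] : exists P Q, [/\ P `<=` `I_N, Q `<=` `I_N, P `&` Q = set0 &
    \sum_(0 <= i < N) `|m [set i]| = m P - m Q].
  have SP : carrier S P by exact: finS PN.
  have SQ : carrier S Q by exact: finS QN.
  have := @Defs.le_variation _ _ _ mu (Element (mem_set SP)) (Element (mem_set SQ))
    (ba_finite_variation mu).
  rewrite -!zero_extensionE /= -ba_normE => h.
  apply: le_trans (h _); last exact: val_inj.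
  exact: le_trans (ler_norm _) (ler_normB _ _).
elim: N => [|N [P [Q [PN QN PQ e]]]].
  by exists set0, set0; split; rewrite ?set0I ?m0 ?subrr ?big_geq.
rewrite big_nat_recr//= e.
have [mN|mN] := leP 0 (m [set N]).
  exists (P `|` [set N]), Q; split; rewrite ?subUset.
  - by split; [exact: subS|exact: sub1].
  - exact: subS.
  - by rewrite setIUl PQ set0U setIC INdisj.
  - rewrite mD; first by rewrite ger0_norm//; lra.
    + exact: finS PN.
    + exact: finS (@sub1 N).
    + exact: INdisj.
exists P, (Q `|` [set N]); split; rewrite ?subUset.
- exact: subS.
- by split; [exact: subS|exact: sub1].
- by rewrite setIUr PQ set0U INdisj.
- rewrite mD; first by rewrite ltr0_norm//; lra.
  + exact: finS QN.
  + exact: finS (@sub1 N).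
  + exact: INdisj.
Qed.

(* By absolute convergence this is the sum of [mu [set i]] over all [i]. *)
Definition atom_sum (mu : V) : R^o := limn (fun N => zero_extension mu `I_N).

Let atom_sum_linear : linear atom_sum.
Proof.
move=> k mu nu; apply: cvg_lim => //.
have -> : (fun N => zero_extension (k *: mu + nu : V) `I_N) =
    (fun N => k *: (zero_extension mu `I_N : R^o) + zero_extension nu `I_N).
  apply/funext => N; rewrite /zero_extension.
  by case: pselect => // -[]; exact: SI.
by apply: cvgD; [apply: cvgZr|]; exact: initial_cvg.
Qed.

HB.instance Definition _ :=
  GRing.isLinear.Build R V R^o *:%R atom_sum atom_sum_linear.

Let atom_sum_le mu : `|atom_sum mu| <= `|mu|.
Proof.
have le N : `|zero_extension mu `I_N| <= `|mu|.
  have SN := SI N.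
  rewrite -[`I_N]/(element_val (Element (mem_set SN))) zero_extensionE.
  exact: ba_le_norm.
rewrite ler_norml; apply/andP; split.
  apply: limr_ge; first exact: initial_cvg.
  by apply: nearW => N; have := le N; rewrite ler_norml => /andP[].
apply: limr_le; first exact: initial_cvg.
by apply: nearW => N; have := le N; rewrite ler_norml => /andP[].
Qed.

Lemma atom_sum_continuous : continuous atom_sum.
Proof.
apply: bounded_linear_continuous; apply/bounded_funP => r; exists r => mu.
exact: le_trans (atom_sum_le mu).
Qed.

Definition atom_sum_dual : dual V := Dual atom_sum_continuous.

End sum_over_atoms.

Section not_Grothendieck.
Variables (R : realType) (X : set nat).
Hypothesis Xinf : forall N, exists2 n, (N <= n)%N & X n.
Local Notation S := (density_algebra X).
Local Notation Z := (density_zero X).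

Let point_at_infinity (A : set nat) : R := (`[< Z (~` A) >] : nat)%:R.

Let uniform n (A : set nat) : R := (cnt A n`!)%:R / n`!%:R.

(* The uniform probability on [0, n!) minus the point mass of the ultrafilter
   of sets of density one. *)
Let nu n (a : elements S) : R :=
  if `[< X n >] then uniform n (element_val a) - point_at_infinity (element_val a)
  else 0.

Let Sa (a : elements S) : carrier S (element_val a).
Proof. exact: set_mem (valP a). Qed.

Let uniform_ge0 n A : 0 <= uniform n A.
Proof. by rewrite divr_ge0. Qed.

Let uniform_le1 n A : uniform n A <= 1.
Proof. by rewrite ler_pdivrMr ?ltr0n ?fact_gt0// mul1r ler_nat cnt_le. Qed.

Let nu_le n a : `|nu n a| <= 1.
Proof.
rewrite /nu /point_at_infinity; case: ifP => _; last by rewrite normr0.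
have := uniform_ge0 n (element_val a); have := uniform_le1 n (element_val a).
by case: asboolP => _ /=; rewrite ler_norml; lra.
Qed.

(** For the point mass: two disjoint elements cannot both have complements in the ideal, as [X] is
    infinite. If neither has, both are in the ideal, and so is their union. *)
Let nu_additive n : fin_additive (nu n).
Proof.
move=> a b /(congr1 (@element_val S)); rewrite element_valI element_val0 => ab.
rewrite /nu element_valU; case: ifP => _; last by rewrite addr0.
have -> : uniform n (element_val a `|` element_val b) =
    uniform n (element_val a) + uniform n (element_val b).
  by rewrite /uniform cntUI// natrD mulrDl.
suff -> : point_at_infinity (element_val a `|` element_val b) =
    point_at_infinity (element_val a) + point_at_infinity (element_val b) by lra.
have nZ := @infinite_density_zeroC X _ Xinf.
have subC (A B : set nat) : A `&` B = set0 -> A `<=` ~` B.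
  by move=> AB x Ax Bx; have : set0 x by rewrite -AB.
rewrite /point_at_infinity setCU -natrD; congr (_%:R)%R.
case: (asboolP (Z (~` element_val a))) => [Za|nZa].
  have -> : `[< Z (~` element_val b) >] = false.
    apply/asboolPn => Zb; apply: nZ Za; apply: sub_density_zero Zb; exact: subC.
  by rewrite (_ : `[< _ >] = true)//; apply/asboolT; apply: sub_density_zero Za => x [].
case: (asboolP (Z (~` element_val b))) => [Zb|nZb].
  by rewrite (_ : `[< _ >] = true)//; apply/asboolT; apply: sub_density_zero Zb => x [].
rewrite (_ : `[< _ >] = false)//; apply/asboolPn; rewrite -setCU; apply: nZ.
by apply: density_zeroU; [have [] := Sa a|have [] := Sa b].
Qed.

Let nu_bounded n a b : `|nu n a| + `|nu n b| <= 1 + 1.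
Proof. exact: lerD. Qed.

Let nu_ba n : nu n \in @ba_pred R _ (elements S).
Proof.
apply/asboolP; split; first exact: nu_additive.
by exists (1 + 1) => _ [a [b [_ ->]]].
Qed.

Let uniform_cvg A e : Z A -> 0 < e -> \forall n \near \oo, X n -> uniform n A <= e.
Proof.
move=> ZA e0; have [k hk] := exists_nat_gt e^-1; have [m hm] := ZA k.
exists m => // n /= mn Xn; have := hm n mn Xn.
rewrite /uniform ler_pdivrMr ?ltr0n ?fact_gt0// -(ler_nat R) natrM => h.
rewrite -ler_pdivrMl//; apply: le_trans h; rewrite ler_wpM2r//; exact: ltW.
Qed.

Lemma density_algebra_not_Grothendieck : ~ Grothendieck_property R (elements S).
Proof.
move=> /(_ (fun n => Ba (nu_ba n))) G.
have nb : norm_bounded (fun n => Ba (nu_ba n)).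
  exists (1 + 1) => n; rewrite ba_normE; apply: Defs.variation_le => a b _ /=.
  exact: nu_bounded.
have pn : pointwise_null (fun n => Ba (nu_ba n)).
  move=> a /=; apply/cvgr0Pnorm_le => e e0.
  have nZ := @infinite_density_zeroC X _ Xinf.
  have [Za|Za] := Sa a; have := uniform_cvg Za e0; apply: filterS => n h.
    rewrite /nu; case: asboolP => [/h{}h|_]; last by rewrite normr0 ltW.
    rewrite /point_at_infinity; case: asboolP => [/(nZ _ Za)//|_] /=.
    by rewrite subr0 ger0_norm.
  rewrite /nu; case: asboolP => [/h{}h|_]; last by rewrite normr0 ltW.
  rewrite /point_at_infinity; case: asboolP => // _ /=.
  suff -> : uniform n (element_val a) - 1 = - uniform n (~` element_val a).
    by rewrite normrN ger0_norm.
  apply/eqP; rewrite subr_eq addrC -subr_eq0 opprB addrA -mulrDl -natrD cntC.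
  by rewrite divff ?subrr// pnatr_eq0 -lt0n fact_gt0.
have /weak_cvgP /(_ (atom_sum_dual R X)) := G nb pn; rewrite linear0 /=.
move=> /cvgr0_norm_lt /(_ 1 ltr01)[m _ hm].
have [n mn Xn] := Xinf m; have := hm n mn.
(* For [N] beyond [n]!, the initial segment has uniform probability 1 and, being finite, point mass
   0. *)
rewrite (_ : atom_sum _ = 1) ?normr1 ?ltxx//.
apply: cvg_lim => //; apply: cvg_near_cst; exists n`! => // N /= nN.
have ZN : Z `I_N by exact: (@density_zero_finite _ _ N).
have SN : carrier S `I_N by left.
rewrite -[`I_N]/(element_val (Element (mem_set SN))) zero_extensionE /= /nu.
rewrite asboolT// /point_at_infinity /=.
case: asboolP => [/(infinite_density_zeroC Xinf ZN)//|_]; rewrite subr0 /uniform.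
rewrite (_ : cnt _ _ = n`!) ?divff ?pnatr_eq0 -?lt0n ?fact_gt0//.
have := cntC `I_N n`!; rewrite (@cnt0 (~` `I_N) N) ?addn0//.
by move=> i /= /negP; rewrite -leqNgt.
Qed.

End not_Grothendieck.

(** * Non-isomorphism *)

(** The singletons are the atoms of both algebras. An isomorphism matches atoms, and an element is
    determined by the atoms below it, so [f] acts as the image under [p]. *)
Lemma isomorphic_permutation (S T : subalgebra) :
  (forall i, carrier S [set i]) -> (forall i, carrier T [set i]) ->
  boolalg_isomorphic (elements S) (elements T) ->
  exists p : nat -> nat, injective p /\
    forall A, carrier T (p @` A) -> carrier S A.
Proof.
move=> S1 T1 [f [[g fK gK] [f0 _] fI _ fC]].
pose s i : elements S := Element (mem_set (S1 i)).
pose t i : elements T := Element (mem_set (T1 i)).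
have ne0 (U : subalgebra) (a : elements U) :
    a <> \bot%O -> exists i, element_val a i.
  move=> a0; apply: contrapT => h; apply: a0; apply: val_inj.
  by apply/seteqP; split => // i ai; apply: h; exists i.
have g0 j : g (t j) <> \bot%O.
  move=> /(congr1 f); rewrite gK f0 => /(congr1 (@element_val T)) e.
  by have : [set j] j by []; rewrite -[[set j]]/(element_val (t j)) e.
have /choice[p hp] : forall i, exists j, element_val (f (s i)) = [set j].
  move=> i; have [|j fj] := ne0 _ (f (s i)).
    rewrite -f0 => /(can_inj fK) /(congr1 (@element_val S)) e.
    by have : [set i] i by []; rewrite -[[set i]]/(element_val (s i)) e.
  (* As [j] lies in [f (s i)], the nonzero element [g (t j)] lies below the atom [s i], hence equals
     it. *)
  exists j; suff : s i = g (t j) by move->; rewrite gK.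
  have gi : (g (t j) `&` s i)%O = g (t j).
    apply: (can_inj fK); rewrite fI gK; apply: val_inj.
    by apply/seteqP; split => [x []//|x /= ->].
  have [x gx] := ne0 _ _ (g0 j).
  have xi y : element_val (g (t j)) y -> y = i.
    by rewrite -gi => -[].
  apply: val_inj; apply/seteqP; split => [y ->|y /xi//].
  by rewrite -(xi _ gx).
have sub a i : element_val a i -> element_val (f a) (p i).
  move=> ai; have e : (s i `&` a)%O = s i.
    by apply: val_inj; apply/seteqP; split => [x []//|x /= ->].
  have : [set p i] (p i) by []; rewrite -hp -e fI element_valI.
  by case.
have iff a i : element_val (f a) (p i) -> element_val a i.
  by move=> fai; apply: contrapT => /(sub (~` a)%O); rewrite fC; apply.
have surj j : exists i, p i = j.
  have [i gi] := ne0 _ _ (g0 j); exists i.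
  by have := sub _ _ gi; rewrite gK.
have pI : injective p.
  move=> i j e; have : f (s i) = f (s j) by apply: val_inj; rewrite /= !hp e.
  move=> /(can_inj fK) /(congr1 (@element_val S)) {}e.
  by have : [set i] i by []; rewrite -[[set i]]/(element_val (s i)) e.
exists p; split => // A TA.
pose a := g (Element (mem_set TA)).
suff <- : element_val a = A by exact: set_mem (valP a).
have fa : element_val (f a) = p @` A by rewrite gK.
apply/seteqP; split => i.
  by move=> /sub; rewrite fa => -[j Aj /pI <-].
by move=> Ai; apply: iff; rewrite fa; exists i.
Qed.

Lemma density_algebra_set1 X i : carrier (density_algebra X) [set i].
Proof. by left; apply: (@density_zero_finite _ _ i.+1) => _ /= ->. Qed.

Lemma density_algebra_not_isomorphic X Y :
  (forall N, exists n, [/\ (N <= n)%N, X n & ~ Y n]) ->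
  ~ boolalg_isomorphic (elements (density_algebra X)) (elements (density_algebra Y)).
Proof.
move=> XY /isomorphic_permutation[||p [pI hp]]; try exact: density_algebra_set1.
(* For each [n] in [X] but not in [Y], [A] receives the even numbers below [n]! that [p] does not
   send below [n.-1]!. Evenness keeps the complement of [A] large. *)
pose A := [set i | ~~ odd i /\
  exists n, [/\ X n, ~ Y n, (i < n`!)%N & (n.-1`! <= p i)%N]].
(* If [m] is in [Y] and [p i < m]!, the [n] witnessing [A i] satisfies [n <= m], and [n <> m]
   because [n] is not in [Y]. So [i] is below [m.-1]!, and the density is at most [1 / m]. *)
have ZpA : density_zero Y (p @` A).
  move=> k; exists (maxn 1 k) => m; rewrite geq_max => /andP[m0 km] Ym.
  have : (cnt (p @` A) m`! <= m.-1`!)%N.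
    apply: (@leq_trans (cnt (p @` A `&` `I_m`!) m`!)).
      by apply: sub_cnt_lt.
    apply: (@cnt_image_bounded p) => _ [[i [_ [n [Xn nYn i_lt p_ge]]] <-]] /= pi_lt.
    exists i => //=; apply: leq_trans i_lt _; apply: leq_fact.
    have : (n.-1 < m)%N.
      rewrite ltnNge; apply/negP => /leq_fact h.
      by have := leq_trans h p_ge; rewrite leqNgt pi_lt.
    have : n <> m by move=> nm; apply: nYn; rewrite nm.
    lia.
  case: m m0 km {Ym} => // m _ km; rewrite factS /= => h.
  by apply: leq_mul.
have [ZA|ZA] := hp A (or_introl ZpA).
(* By injectivity of [p], [A] misses at most [n.-1]! even numbers below [n]!. Density at most 1/4
   would then give [n <= 4]. *)
- have [m hm] := ZA 4%N; have [n [+ Xn nYn]] := XY (maxn m 5).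
  rewrite geq_max => /andP[mn n5].
  have : (cnt [set i | ~~ odd i] n`! <= cnt A n`! + n.-1`!)%N.
    pose B := [set i | (p i < n.-1`!)%N].
    apply: (@leq_trans (cnt A n`! + cnt B n`!)%N).
      apply: leq_trans (cntU _ _ _); apply: sub_cnt_lt => i i_lt ev.
      by have [?|?] := ltnP (p i) n.-1`!; [right|left; split => //; exists n].
    by rewrite leq_add2l; apply: (@cnt_inj_bounded p).
  have := hm n mn Xn; have /andP[+ _] := cnt_even n`!.
  case: n n5 {mn Xn nYn} => // n n5; rewrite factS /=.
  move: (cnt _ _) (cnt _ _) (fact_gt0 n) => a b; move: n`! => u; nia.
(* The complement contains all odd numbers; density at most 1/4 would give [n]! at most 2. *)
- have [m hm] := ZA 4%N; have [n [+ Xn nYn]] := XY (maxn m 3).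
  rewrite geq_max => /andP[mn n3].
  have : (cnt (~` [set i | ~~ odd i]) n`! <= cnt (~` A) n`!)%N.
    by apply: sub_cnt => i /= nev [].
  have := hm n mn Xn; have /andP[_ +] := cnt_even n`!.
  have := cntC [set i | ~~ odd i] n`!.
  have := leq_fact n3; rewrite (_ : 3`! = 6)%N//; lia.
Qed.

(** * Almost disjoint sets indexed by the reals *)

Section almost_disjoint.
Variable R : realType.

(** The power of 2 recovers [n] and the odd factor recovers [z]; moreover [n <= code n z], so large
    [n] have large codes. *)
Definition code n (z : int) := (2 ^ n * (2 * pickle z).+1)%N.

Lemma code_inj n n' z z' : code n z = code n' z' -> n = n' /\ z = z'.
Proof.
rewrite /code; elim: n n' => [|n IH] [|n'].
- by rewrite !expn0 !mul1n => -[]/eqP; rewrite eqn_mul2l /= => /eqP /(pcan_inj pickleK).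
- by rewrite expn0 expnS; lia.
- by rewrite expn0 expnS; lia.
- by rewrite !expnS -!mulnA => /eqP; rewrite eqn_mul2l /= => /eqP /IH[-> ->].
Qed.

Definition slope_set (r : R) := [set code n (Num.floor (r * n%:R)) | n in [set: nat]].

(** Equal codes have equal [n], and as soon as [|r - t| * n > 1] the floors of [r * n] and [t * n]
    differ. *)
Lemma slope_set_diff r t N : r != t ->
  exists n, [/\ (N <= n)%N, slope_set r n & ~ slope_set t n].
Proof.
move=> rt; have [k hk] := exists_nat_gt `|r - t|^-1.
pose n := maxn N k; exists (code n (Num.floor (r * n%:R))); split.
- apply: (@leq_trans n); first exact: leq_maxl.
  by rewrite /code; apply: (@leq_trans (2 ^ n));
    [exact/ltnW/ltn_expl|rewrite leq_pmulr].
- by exists n.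
move=> [n' _ /code_inj[-> e]].
have rt0 : 0 < `|r - t| by rewrite normr_gt0 subr_eq0.
have : 1 < `|r - t| * n%:R.
  rewrite -ltr_pdivrMl// mulr1; apply: (lt_le_trans hk).
  by rewrite ler_nat leq_maxr.
rewrite -[n%:R]normr_nat -normrM mulrBl.
have := floor_le (r * n%:R); have := floorD1_gt (r * n%:R).
have := floor_le (t * n%:R); have := floorD1_gt (t * n%:R).
rewrite -e !intrD; move: (r * _) (t * _) (_%:~R) => a b c ? ? ? ?.
by rewrite ltNge ler_norml; lra.
Qed.

Lemma slope_set_infinite r N : exists2 n, (N <= n)%N & slope_set r n.
Proof.
have [|n [? ? _]] := @slope_set_diff r (r + 1) N; last by exists n.
by rewrite -subr_eq0 opprD addrA subrr sub0r oppr_eq0 oner_eq0.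
Qed.

End almost_disjoint.

Theorem theoremA (R : realType) :
  exists H1 : set subalgebra,
    [/\ (H1 #= [set: R])%card,
        (forall S T : subalgebra, H1 S -> H1 T -> S <> T ->
          ~ boolalg_isomorphic (elements S) (elements T)),
        (forall S : subalgebra, H1 S -> Fsigmadelta (char_set S)) &
        (forall S : subalgebra, H1 S ->
          Nikodym_property R (elements S) /\
          ~ Grothendieck_property R (elements S))].
Proof.
pose A (r : R) := density_algebra (slope_set r).
have noniso r t : r != t -> ~ boolalg_isomorphic (elements (A r)) (elements (A t)).
  by move=> rt; apply: density_algebra_not_isomorphic => N; exact: slope_set_diff.
(* Equal algebras are isomorphic by the identity, so non-isomorphism also yields the cardinality of
   the family. *)
have A_inj : injective A.
  move=> r t e; apply/eqP; apply: contrapT => /negP /noniso; rewrite e; apply.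
  by exists id; split => //; exists id.
exists [set A r | r in [set: R]]; split.
- by apply: inj_card_eq => r t _ _; exact: A_inj.
- move=> _ _ [r _ <-] [t _ <-] rt; apply: noniso.
  by apply/eqP => e; apply: rt; rewrite e.
- by move=> _ [r _ <-]; exact: density_algebra_Fsigmadelta.
- move=> _ [r _ <-]; split; first exact: density_algebra_Nikodym.
  by apply: density_algebra_not_Grothendieck; exact: slope_set_infinite.
Qed.
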